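(* Let $Q\in\mathcal{Q}(n,d,m)$ and $\underline{\delta}\in\Omega_2(Q)$. Then $|\underline{\delta}|\leq m(d-n-1)+2n$.
   Context: A quiver $Q$ is a finite oriented graph; for an arrow $a$, $a''$ is its tail and $a'$ its head. A path $a=a_1\cdots a_s$ ($a_i$ arrows) satisfies $a_i'=a_{i+1}''$; it is closed if $a_1''=a_s'$; $V(a)=\{a_1'',a_1',\dots,a_s'\}$, $A(a)=\{a_1,\dots,a_s\}$. A closed path is primitive if each vertex of $V(a)$ is the head of exactly one $a_i$. $m(Q)$ is the maximal degree of a primitive closed path; $Q$ is strongly connected if some closed path contains all vertices; $\mathcal{Q}(n,d,m)$ is the set of strongly connected quivers with $n$ vertices, $d$ arrows and $m(Q)=m$. The multidegree $\mathrm{mdeg}(a)\in\mathbb{N}^{\#A(Q)}$ has $b$-component equal to the number of $i$ with $a_i=b$; $|\underline{\delta}|=\sum_b\delta_b$. For a nonzero $\underline{\delta}\in\mathbb{N}^{\#A(Q)}$, its support $Q_{\underline{\delta}}$ is the subquiver with arrows $\{a:\delta_a\geq1\}$ and vertices the heads and tails of these arrows; $\underline{\delta}$ is decomposable (with respect to $Q$) if $Q_{\underline{\delta}}$ is not strongly connected but is a disjoint union of strongly connected quivers. $\Omega_0(Q)$ is the set of $\mathrm{mdeg}(h)$ for closed paths $h$ in $Q$ with $A(h)=A(Q)$. A path $a$ is $\underline{\delta}$-double if it is a primitive closed path and $\delta_{a_i}\geq2$ for all $i$. $\Omega_2(Q)$ is the set of $\underline{\delta}\in\Omega_0(Q)$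 such that for every $\underline{\delta}$-double path $a$ in $Q$ the vector $\underline{\delta}-2\,\mathrm{mdeg}(a)$ is decomposable with respect to $Q$. *)

(* Defs.v *)
From mathcomp Require Import all_boot all_order all_algebra.
Set Implicit Arguments. Unset Strict Implicit. Unset Printing Implicit Defensive.

Section Quiver.
Variables (n d : nat) (tl hd : 'I_d -> 'I_n).

Definition qpath (p : seq 'I_d) : bool :=
  match p with
  | [::] => false
  | a :: p' => path (fun x y => hd x == tl y) a p'
  end.

Definition qclosed (p : seq 'I_d) : bool :=
  match p with
  | [::] => false
  | a :: p' => qpath p && (tl a == hd (last a p'))
  end.

Definition pverts (p : seq 'I_d) : {set 'I_n} :=
  match p with
  | [::] => set0
  | a :: _ => tl a |: [set v | has (fun b => hd b == v) p]
  end.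

Definition parrows (p : seq 'I_d) : {set 'I_d} := [set b | b \in p].

Definition qprimitive (p : seq 'I_d) : bool :=
  qclosed p && [forall v in pverts p, count (fun b => hd b == v) p == 1].

Definition mdeg (p : seq 'I_d) : 'I_d -> nat := fun b => count_mem b p.

Definition mQ_is (m : nat) : Prop :=
  (exists p, qprimitive p /\ size p = m) /\
  (forall p, qprimitive p -> size p <= m).

Definition strongly_connected : Prop :=
  exists p, qclosed p /\ [set: 'I_n] \subset pverts p.

Definition sub_verts (S : {set 'I_d}) : {set 'I_n} :=
  [set v | [exists a in S, (tl a == v) || (hd a == v)]].

Definition sub_strongly_connected (S : {set 'I_d}) : Prop :=
  exists p, [/\ qclosed p, all (fun a => a \in S) p & sub_verts S \subset pverts p].

Definition dsupport (delta : 'I_d -> nat) : {set 'I_d} := [set a | 0 < delta a].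

Definition vdisjoint (a b : 'I_d) : bool :=
  [&& tl a != tl b, tl a != hd b, hd a != tl b & hd a != hd b].

(* delta decomposable: delta nonzero, Q_delta not strongly connected, but Q_delta is
   a disjoint union of strongly connected subquivers (given by a colouring c of
   its arrows: differently coloured arrows share no vertex, each colour class
   spans a strongly connected subquiver) *)
Definition decomposable (delta : 'I_d -> nat) : Prop :=
  let S := dsupport delta in
  [/\ exists a, 0 < delta a,
      ~ sub_strongly_connected S &
      exists c : 'I_d -> nat,
        (forall a b, a \in S -> b \in S -> c a != c b -> vdisjoint a b) /\
        (forall k, (exists2 a, a \in S & c a = k) ->
           sub_strongly_connected [set a in S | c a == k])].

Definition Omega0 (delta : 'I_d -> nat) : Prop :=
  exists p, [/\ qclosed p, parrows p = [set: 'I_d] & forall b, delta b = mdeg p b].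

Definition ddouble (delta : 'I_d -> nat) (p : seq 'I_d) : bool :=
  qprimitive p && all (fun a => 2 <= delta a) p.

Definition Omega2 (delta : 'I_d -> nat) : Prop :=
  Omega0 delta /\
  forall p, ddouble delta p -> decomposable (fun b => delta b - 2 * mdeg p b).

End Quiver.

(* Main.v *)
Require Import Defs.
From mathcomp Require Import all_boot all_order all_algebra.
From mathcomp Require Import zify.

(** Greedily write delta as a sum of primitive closed paths, each taken with
   multiplicity 2 if it is double at that stage and 1 otherwise.  A path taken
   once contains an arrow that no later path uses; a path [c] taken twice
   contains an arrow that no other path uses, because delta - 2 mdeg(c) is
   decomposable.  Deleting these arrows keeps the quiver connected, so the number
   [N] of paths is at most d - n + 1.  In the graph on the paths where adjacency
   means sharing a vertex, every path taken twice is moreover a cut vertex.  A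
   connected graph with [q] non-cut vertices becomes bipartite after deleting
   [q - 2] vertices, and pairwise disjoint primitive paths have total length at
   most [n].  Hence the lengths of all paths, counted once, add up to at most
   2n + m (q - 2), and counting the at most [N - q] doubled paths once more gives
   |delta| <= 2n + m (N - 2) <= 2n + m (d - n - 1). *)

Set Implicit Arguments. Unset Strict Implicit. Unset Printing Implicit Defensive.

(** * Connected sets, non-cut vertices and bipartite subsets of a finite graph *)

Section ConnectedSets.
Variables (T : finType) (adj : rel T).
Hypothesis adjC : symmetric adj.
Implicit Types (Y Z I J : {set T}) (x y v : T).

(** Connectivity in cut form, without walks: the crossing edge it supplies is what every growth
    argument consumes. *)
Definition conn Y := (Y != set0) &&
  [forall Z : {set T}, (Z \proper Y) && (Z != set0) ==>
     [exists x in Z, [exists y in Y :\: Z, adj x y]]].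

Lemma connP Y :
  reflect (Y != set0 /\ forall Z, Z \proper Y -> Z != set0 ->
             exists x y, [/\ x \in Z, y \in Y, y \notin Z & adj x y]) (conn Y).
Proof.
apply: (iffP andP) => -[Y0 H]; split=> //.
  move=> Z ZY Z0; move/forallP/(_ Z): H; rewrite ZY Z0 /=.
  case/exists_inP=> x xZ /exists_inP[y]; rewrite inE => /andP[yZ yY] xy.
  by exists x, y.
apply/forallP=> Z; apply/implyP=> /andP[ZY Z0].
have [x [y [xZ yY yZ xy]]] := H _ ZY Z0.
by apply/exists_inP; exists x => //; apply/exists_inP; exists y; rewrite ?inE ?yZ.
Qed.

Lemma conn1 x : conn [set x].
Proof.
apply/connP; split; first by apply/set0Pn; exists x; rewrite inE.
by move=> Z; rewrite properEneq subset1 => /andP[Zx /orP[ZE|->//]]; rewrite ZE in Zx.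
Qed.

Lemma conn_add Z z y : conn Z -> z \in Z -> adj z y -> conn (y |: Z).
Proof.
move=> /connP[Z0 HZ] zZ zy; apply/connP; split.
  by apply/set0Pn; exists y; rewrite setU11.
move=> W /properP[WY [w wY wW]] /set0Pn[t tW].
have [ZW|ZW] := boolP (Z \subset W).
  exists z, w; move: wY; rewrite !inE => /orP[/eqP wy|wZ].
    by rewrite (subsetP ZW) ?wy ?eqxx -?wy //; split=> //; rewrite wy.
  by rewrite (subsetP ZW) in wW.
have [E|WZ0] := eqVneq (W :&: Z) set0.
  have /setP/(_ t) := E; rewrite !inE tW /= => tZ.
  have ty : t = y by have /setU1P[//|] := subsetP WY _ tW; rewrite tZ.
  exists t, z; rewrite !inE zZ orbT ty adjC -{1}ty; split=> //.
  by apply/negP=> zW; have /setP/(_ z) := E; rewrite !inE zW zZ.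
have [|x [u [xW uZ uW xu]]] := HZ (W :&: Z) _ WZ0.
  rewrite properE subsetIr; apply: contra ZW => /subset_trans; apply.
  exact: subsetIl.
exists x, u; move: xW uW; rewrite !inE uZ orbT andbT => /andP[-> _] ->.
by split.
Qed.

(** Growing along crossing edges can stop at any cardinality; stopping one vertex short of [Y] is
    what produces non-cut vertices. *)
Lemma conn_grow (P : {set T} -> Prop) Y :
    (forall x, x \in Y -> P [set x]) ->
    (forall Z z y, Z \subset Y -> P Z -> z \in Z -> y \in Y -> y \notin Z ->
       adj z y -> P (y |: Z)) ->
  conn Y -> forall k, k < #|Y| -> exists Z, [/\ Z \subset Y, #|Z| = k.+1 & P Z].
Proof.
move=> P1 PU /connP[/set0Pn[x xY] HY]; elim=> [|k IH] kY.
  by exists [set x]; rewrite sub1set cards1; split=> //; apply: P1.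
have [Z [ZY cZ PZ]] := IH (ltnW kY).
have [| |z [y [zZ yY yZ zy]]] := HY Z.
- by rewrite properEcard ZY cZ.
- by rewrite -card_gt0 cZ.
exists (y |: Z); rewrite subUset sub1set yY ZY cardsU1 yZ cZ; split=> //.
exact: PU zy.
Qed.

Lemma conn_ind (P : {set T} -> Prop) Y :
    (forall x, x \in Y -> P [set x]) ->
    (forall Z z y, Z \subset Y -> P Z -> z \in Z -> y \in Y -> y \notin Z ->
       adj z y -> P (y |: Z)) ->
  conn Y -> P Y.
Proof.
move=> P1 PU cY; have Y0 : 0 < #|Y| by rewrite card_gt0; case/connP: cY.
have [|Z [ZY cZ PZ]] := conn_grow P1 PU cY (k := #|Y|.-1).
  by rewrite prednK.
suff /eqP <- : Z == Y by [].
by rewrite eqEcard ZY cZ prednK ?leqnn.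
Qed.

Definition noncut Y := [set v in Y | conn (Y :\ v)].

(** A connected subset grown to all but one vertex of [Y] leaves out a non-cut vertex. *)
Lemma noncut_exists Y : conn Y -> 1 < #|Y| -> exists v, v \in noncut Y.
Proof.
move=> cY Y1; have Y2 : #|Y|.-2 < #|Y| by case: #|Y| Y1 => [|[|k]].
have [||Z [ZY cZ kZ]] := conn_grow (P := conn) _ _ cY Y2.
- by move=> x _; apply: conn1.
- by move=> Z z y _ cZ zZ _ _; apply: conn_add.
have : 0 < #|Y :\: Z|.
  rewrite cardsD (setIidPr ZY) cZ subn_gt0.
  by case: #|Y| Y1 => [|[|k]].
case/card_gt0P=> v /setDP[vY vZ]; exists v; rewrite inE vY.
have <- : Z = Y :\ v; last by [].
apply/eqP; rewrite eqEcard cZ subsetD1 ZY vZ /=.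
by have := cardsD1 v Y; rewrite vY; case: #|Y| Y1 => [|[|k]] //= _ [->].
Qed.

(** Loops are tolerated, since [meet_rel] relates every closed path to itself. *)
Definition indep I := {in I &, forall x y, adj x y -> x = y}.

Lemma indepU1 I v : indep I -> (forall y, y \in I -> ~~ adj v y) -> indep (v |: I).
Proof.
move=> iI vI x y /setU1P[->|xI] /setU1P[->|yI] //; last exact: iI.
  by rewrite (negPf (vI _ yI)).
by rewrite adjC (negPf (vI _ xI)).
Qed.

(* Removing a non-cut vertex [v] with two neighbours creates no new non-cut
   vertex, so [v] may be discarded; a [v] of degree one can be coloured. *)
Lemma conn_bipartite Y : conn Y -> 1 < #|Y| ->
  exists I J, [/\ indep I, indep J, [disjoint I & J], I :|: J \subset Y &
    #|Y :\: (I :|: J)| + 2 <= #|noncut Y|].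
Proof.
have [k] := ubnP #|Y|; elim: k Y => // k IH Y Yk cY Y1.
have [v] := noncut_exists cY Y1; rewrite inE => /andP[vY cYv].
have Yv : #|Y| = #|Y :\ v|.+1 by rewrite (cardsD1 v) vY.
(* Two vertices: both are non-cut and nothing is deleted, so the bound reads [0 + 2 <= 2]. *)
have [Y2|Y2] := leqP #|Y :\ v| 1.
  have /cards1P[u Eu] : #|Y :\ v| == 1.
    by rewrite eqn_leq Y2 -ltnS -Yv Y1.
  have uv : u != v by have := set11 u; rewrite -Eu !inE => /andP[].
  have EY : Y = [set v; u] by rewrite -(setD1K vY) Eu.
  exists [set v], [set u]; split.
  - by move=> x y /set1P-> /set1P->.
  - by move=> x y /set1P-> /set1P->.
  - by rewrite disjoints1 inE eq_sym.
  - by rewrite EY.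
  have -> : noncut Y = Y.
    apply/setP=> x; rewrite inE; case: (boolP (x \in Y)) => //=.
    rewrite {1}EY => /set2P[->|->] //.
    have -> : Y :\ u = [set v]; last exact: conn1.
    apply/setP=> y; rewrite EY !inE; case: (eqVneq y u) => //= [->|_].
      by rewrite (negPf uv).
    by rewrite orbF.
  by rewrite {1}EY setDv cards0 Yv Eu cards1.
have Yv' : #|Y :\ v| < k by rewrite -ltnS -Yv.
have {IH} [I [J [iI iJ dIJ IJY bX]]] := IH _ Yv' cYv Y2.
have [IY JY] : I \subset Y :\ v /\ J \subset Y :\ v by apply/andP; rewrite -subUset.
have vIJ : v \notin I :|: J.
  by apply/negP=> /(subsetP IJY); rewrite !inE eqxx.
(* A neighbour [z] of [v] other than [u] reattaches [v] to the connected set [Y :\ v :\ u]. *)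
have noncut_back u z : u \in noncut (Y :\ v) -> z \in Y -> z != u -> z != v ->
    adj z v -> u \in noncut Y.
  rewrite !inE => /andP[/andP[uv uY] cu] zY zu zv a; rewrite uY /=.
  have -> : Y :\ u = v |: (Y :\ v :\ u).
    apply/setP=> x; rewrite !inE; case: (eqVneq x v) => [->|//].
    by rewrite vY eq_sym uv.
  by apply: (conn_add (z := z) cu) => //; rewrite !inE zu zv.
have [z [zY zv a]] : exists z, [/\ z \in Y, z != v & adj z v].
  have /connP[_ H] := cY; have [| |x [y [xv yY yv xy]]] := H [set v].
  - by rewrite properEcard sub1set vY cards1.
  - by apply/set0Pn; exists v; rewrite inE.
  move: xv yv xy; rewrite !inE => /eqP-> yv vy; exists y.
  by rewrite yY yv adjC vy.
have [/exists_inP[z' z'Y /and3P[z'v z'z a']]|Hz] :=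
  boolP [exists z' in Y, [&& z' != v, z' != z & adj z' v]].
  exists I, J; split=> //; first by rewrite (subset_trans IJY) ?subD1set.
  have nc : noncut (Y :\ v) \subset noncut Y :\ v.
    apply/subsetP=> u uN; rewrite in_setD1.
    have -> : u != v by move: uN; rewrite !inE; case: eqP.
    have [uz|uz] := eqVneq u z; last by apply: noncut_back a; rewrite // eq_sym.
    by apply: noncut_back a'; rewrite // uz.
  (* The deleted set gains [v], but [v] is itself one more non-cut vertex of [Y]. *)
  have := subset_leq_card nc; rewrite (cardsD1 v (noncut Y)) inE vY cYv add1n.
  move=> /(leq_trans bX); rewrite -(ltnS _ #|_ :\ v|); apply: leq_trans.
  rewrite (cardsD1 v (Y :\: _)) inE vIJ vY /= add1n addSn ltnS leq_add2r.
  by apply/subset_leq_card/subsetP=> x; rewrite !inE; case: eqP; rewrite ?andbF.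
have adjv y : y \in Y -> y != v -> adj v y -> y = z.
  move=> yY yv vy; apply/eqP; apply: contraNT Hz => yz.
  by apply/exists_inP; exists y => //; rewrite yv yz adjC.
(* Only [z] can cease to be non-cut, and [v] makes up for it. *)
have nc : #|noncut (Y :\ v)| <= #|noncut Y|.
  have : noncut (Y :\ v) \subset z |: noncut Y :\ v.
    apply/subsetP=> u uN; rewrite in_setU1 in_setD1.
    have -> : u != v by move: uN; rewrite !inE; case: eqP.
    by case: eqVneq => //= uz; apply: noncut_back a; rewrite // eq_sym.
  move/subset_leq_card => /leq_trans; apply.
  rewrite (cardsD1 v (noncut Y)) inE vY cYv cardsU1 leq_add2r.
  by case: (_ \notin _).
have disjv (L K : {set T}) : L \subset Y :\ v -> K \subset Y :\ v -> [disjoint L & K] ->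
    z \notin L -> indep L -> [/\ indep (v |: L) & [disjoint v |: L & K]].
  move=> LY KY dLK zL iL; split.
    apply: indepU1 => // y yL; apply/negP=> /adjv E.
    have /setD1P[yv yY] := subsetP LY _ yL.
    by rewrite E // (negPf zL) in yL.
  rewrite -setI_eq0 setIUl setU_eq0 !setI_eq0 dLK disjoints1 andbT.
  by apply/negP=> /(subsetP KY); rewrite !inE eqxx.
have bX' : #|Y :\: (v |: (I :|: J))| + 2 <= #|noncut Y|.
  apply: leq_trans nc; apply: leq_trans bX; rewrite leq_add2r.
  by apply/subset_leq_card/subsetP=> x; rewrite !inE negb_or -!andbA andbCA andbA andbC.
have sub : v |: (I :|: J) \subset Y.
  by rewrite subUset sub1set vY (subset_trans IJY) ?subD1set.
(* [v] joins [J] if its only neighbour [z] lies in [I], and joins [I] otherwise, which also covers a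
   deleted [z]. *)
have [zI|zI] := boolP (z \in I).
  have zJ : z \notin J by rewrite (disjointFr dIJ zI).
  have [//|||iJ' dJ] := disjv J I JY IY; rewrite 1?disjoint_sym //.
  exists I, (v |: J); split=> //; first by rewrite disjoint_sym.
    by rewrite setUCA.
  by rewrite setUCA.
have [iI' dI] := disjv I J IY JY dIJ zI iI.
by exists (v |: I), J; split=> //; rewrite -setUA.
Qed.

End ConnectedSets.

(** * Closed and primitive paths, their vertices, and splicing *)

Section ClosedPaths.
Variables (n d : nat) (tl hd : 'I_d -> 'I_n).
Implicit Types (p q : seq 'I_d) (S : {set 'I_d}) (W : {set 'I_n}) (f : 'I_n -> nat).

Lemma qclosedE p :
  qclosed tl hd p = (p != [::]) && cycle (fun a b => hd a == tl b) p.
Proof. by case: p => [//|a p] /=; rewrite rcons_path (eq_sym (tl a)). Qed.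

Lemma path_ends a p : path (fun a b => hd a == tl b) a p ->
  map tl p = map hd (belast a p).
Proof. by elim: p a => //= b p IH a /andP[/eqP-> /IH->]. Qed.

(** Each tail is the head of the cyclically preceding arrow, so the tails are a rotation of the
    heads. *)
Lemma qclosed_perm p : qclosed tl hd p -> perm_eq (map tl p) (map hd p).
Proof.
rewrite qclosedE; case: p => // a p /= /path_ends.
by rewrite belast_rcons /= => <-; rewrite map_rcons perm_sym perm_rcons.
Qed.

Lemma pvertsE p : qclosed tl hd p -> pverts tl hd p = [set v in map hd p].
Proof.
move=> cp; apply/setP=> v; have vt := perm_mem (qclosed_perm cp) v.
case: p cp vt => // a p cp vt; rewrite in_setU1 !inE.
rewrite -[has _ _]/(has (fun b => hd b == v) (a :: p)).
have -> : has (fun b => hd b == v) (a :: p) = (v \in map hd (a :: p)).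
  by apply/hasP/mapP=> -[b bp] => [/eqP<-|->]; exists b.
by rewrite -in_cons -vt inE; case: eqP.
Qed.

Lemma hd_pverts p a : qclosed tl hd p -> a \in p -> hd a \in pverts tl hd p.
Proof. by move=> cp ap; rewrite pvertsE // inE map_f. Qed.

Lemma tl_pverts p a : qclosed tl hd p -> a \in p -> tl a \in pverts tl hd p.
Proof.
by move=> cp ap; rewrite pvertsE // inE -(perm_mem (qclosed_perm cp)) map_f.
Qed.

Lemma pverts_neq0 p : qclosed tl hd p -> pverts tl hd p != set0.
Proof.
case: p => // a p cp; apply/set0Pn; exists (hd a).
by apply: hd_pverts; rewrite ?mem_head.
Qed.

Lemma qprimitiveE p : qprimitive tl hd p = qclosed tl hd p && uniq (map hd p).
Proof.
rewrite /qprimitive; have [cp|//] := boolP (qclosed tl hd p); rewrite /=.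
have cE v : count (fun b => hd b == v) p = count_mem v (map hd p).
  by rewrite count_map.
apply/forall_inP/idP => [H|H v].
  apply: count_mem_uniq => v; have := H v; rewrite pvertsE // inE cE.
  case: (boolP (v \in _)) => [_ /(_ isT)/eqP //|vp _].
  by apply/eqP; rewrite -leqn0 leqNgt -has_count has_pred1.
by rewrite pvertsE // inE cE count_uniq_mem // => ->.
Qed.

Lemma card_pverts p : qprimitive tl hd p -> #|pverts tl hd p| = size p.
Proof.
by rewrite qprimitiveE => /andP[cp /card_uniqP]; rewrite pvertsE // cardsE size_map.
Qed.

(** Rotate both paths to start at an arrow with tail [v], then concatenate. *)
Lemma qclosed_splice p q v : qclosed tl hd p -> qclosed tl hd q ->
  v \in pverts tl hd p -> v \in pverts tl hd q ->
  exists2 r, qclosed tl hd r & r =i p ++ q.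
Proof.
move=> cp cq; rewrite !pvertsE // !inE.
rewrite -(perm_mem (qclosed_perm cp)) -(perm_mem (qclosed_perm cq)).
case/mapP=> a ap va /mapP[b bq vb].
case: (rot_to ap) => i p' Ep; case: (rot_to bq) => j q' Eq.
move: cp cq; rewrite !qclosedE -[cycle _ p](rot_cycle i) -[cycle _ q](rot_cycle j) Ep Eq /=.
move=> /andP[_ + ] /andP[_].
rewrite !rcons_path => /andP[Pp Lp] /andP[Pq Lq].
exists ((a :: p') ++ (b :: q')).
  rewrite qclosedE /= rcons_path cat_path last_cat /= Pp Pq -vb va Lp.
  by rewrite -va vb Lq.
by move=> x; rewrite !mem_cat -Ep -Eq (mem_rot i p) (mem_rot j q).
Qed.

(** * Multidegrees, balanced vectors and decomposition into primitive closed paths *)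

Lemma mdeg_gt0 p b : (0 < mdeg p b) = (b \in p).
Proof. by rewrite /mdeg -has_count has_pred1. Qed.

Lemma mdeg_qprimitive p b : qprimitive tl hd p -> mdeg p b = (b \in p).
Proof.
by rewrite qprimitiveE => /andP[_ /map_uniq up]; rewrite /mdeg count_uniq_mem.
Qed.

Lemma sum_mdeg p (F : 'I_d -> nat) : \sum_b mdeg p b * F b = \sum_(a <- p) F a.
Proof.
elim: p => [|a p IH]; first by rewrite big_nil big1.
rewrite big_cons -IH /mdeg /=; under eq_bigr do rewrite mulnDl.
rewrite big_split /= (bigD1 a) //= eqxx mul1n big1 ?addn0 // => b.
by rewrite eq_sym => /negPf->.
Qed.

(** Conservation of flow at every vertex, in linear form; indicator functions [f] recover single
    vertices and vertex sets. *)
Definition balanced (delta : 'I_d -> nat) :=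
  forall f, \sum_a delta a * f (hd a) = \sum_a delta a * f (tl a).

Lemma balanced_mdeg p : qclosed tl hd p -> balanced (mdeg p).
Proof.
move=> cp f; rewrite (sum_mdeg p (f \o hd)) (sum_mdeg p (f \o tl)).
by rewrite -(big_map hd predT) -(big_map tl predT) -(perm_big _ (qclosed_perm cp)).
Qed.

Lemma balanced_sub k delta delta' p : qclosed tl hd p -> balanced delta ->
  (forall b, delta b = k * mdeg p b + delta' b) -> balanced delta'.
Proof.
move=> cp bd E f; have := bd f.
under eq_bigr do rewrite E mulnDl -mulnA.
under [in X in _ = X]eq_bigr do rewrite E mulnDl -mulnA.
rewrite !big_split /= -!big_distrr /= (balanced_mdeg cp).
exact: addnI.
Qed.

(** By balance, an arrow of the support leaves the head of each such arrow. Following one chosen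
    arrow per vertex must repeat, and the loop so closed has distinct vertices. *)
Lemma balanced_qprimitive delta a0 : balanced delta -> 0 < delta a0 ->
  exists2 p, qprimitive tl hd p & all (fun a => 0 < delta a) p.
Proof.
move=> bd da0.
(* The default [a0] keeps [delta (o v)] positive even where no arrow of the support leaves [v]. *)
pose o v := odflt a0 [pick b | (0 < delta b) && (tl b == v)].
have o_gt0 v : 0 < delta (o v) by rewrite /o; case: pickP => //= b /andP[].
have tl_o a : 0 < delta a -> tl (o (hd a)) = hd a.
  move=> da; rewrite /o; case: pickP => [b /andP[_ /eqP]//|none].
  (* Test balance at [hd a]: the inflow is at least [delta a], while the outflow would vanish. *)
  have := bd (fun v => v == hd a); rewrite (bigD1 a) //= eqxx muln1.
  rewrite [in RHS]big1 => [/eqP|b _].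
    by rewrite addn_eq0 eqn0Ngt da.
  by have := none b; case: (posnP (delta b)) => [->|_ /= ->]; rewrite ?muln0.
pose g v := hd (o v); pose x := hd a0.
have tl_orbit i : tl (o (iter i g x)) = iter i g x.
  by case: i => [|i]; rewrite ?iterS; apply: tl_o.
(* The orbit of [x] returns to its point of index [i]; dropping the first [i] points leaves [s]
   distinct vertices that [g] permutes cyclically. *)
have := looping_order g x; rewrite /looping => /trajectP[i lt_i Ei].
have Es : fingraph.order g x = i + (fingraph.order g x - i) by rewrite subnKC // ltnW.
have := orbit_uniq g x; rewrite /orbit; move: Es Ei.
set s := _ - i => -> /[1!addnC] /[1!iterD] Eiter.
have s0 : 0 < s by rewrite subn_gt0.
rewrite addnC trajectD cat_uniq => /and3P[_ _].
set y := iter i g x in Eiter * => uy.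
have tl_y j : tl (o (iter j g y)) = iter j g y by rewrite /y -iterD tl_orbit.
exists [seq o v | v <- traject g y s]; last first.
  by apply/allP=> _ /mapP[v _ ->].
case: s s0 Eiter uy => // s _ Eiter uy.
have Et : traject g (g y) s.+1 = rcons (traject g (g y) s) y.
  by rewrite trajectSr -iterSr Eiter.
have gE z k : map g (traject g z k) = traject g (g z) k.
  by elim: k z => //= k IH z; rewrite IH.
rewrite qprimitiveE qclosedE -andbA; apply/and3P; split=> //; last first.
  by rewrite -map_comp [map _ _]gE Et rcons_uniq.
apply: (@homo_cycle_in _ _ (fun v => tl (o v) == v) o (frel g)).
- by move=> u v _ /eqP-> /= /eqP<-.
- apply/allP=> v /trajectP[j _ ->]; exact/eqP.
- by rewrite [traject _ _ _]/= /= -Et fpath_traject.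
Qed.

(** Induction on the total of [delta]: peel off a primitive path, twice when [delta] is at least 2
    along it. The boolean records doubling; a path taken once exhausts one of its arrows. *)
Lemma cycle_decomposition delta : balanced delta ->
  exists s : seq (bool * seq 'I_d),
  [/\ forall x, x \in s -> qprimitive tl hd x.2,
      forall b, delta b = \sum_(x <- s) (x.1 : nat).+1 * mdeg x.2 b &
      forall x0 i, i < size s -> ~~ (nth x0 s i).1 ->
        exists2 e, e \in (nth x0 s i).2 &
          forall j, i < j < size s -> e \notin (nth x0 s j).2].
Proof.
have [k] := ubnP (\sum_b delta b); elim: k delta => // k IH delta dk bd.
case: (pickP (fun a => 0 < delta a)) => [a0 /(balanced_qprimitive bd)|d0]; last first.
  exists [::]; split=> // b; rewrite big_nil.
  by apply/eqP; rewrite eqn0Ngt d0.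
case=> p pp /allP dp; have cp : qclosed tl hd p by case/andP: pp.
pose t := all (fun a => 1 < delta a) p.
pose delta' b := delta b - t.+1 * mdeg p b.
have dE b : delta b = t.+1 * mdeg p b + delta' b.
  rewrite subnKC // (mdeg_qprimitive _ pp); case: (boolP (b \in p)) => bp.
    rewrite muln1 /t; case: allP => [/(_ _ bp)//|_]; exact: dp.
  by rewrite muln0.
have lt_k : \sum_b delta' b < k.
  rewrite -ltnS; apply: leq_trans dk; rewrite ltnS.
  have [a ap] : exists a, a \in p.
    by case: p cp {pp dp t delta' dE} => // a p; exists a; rewrite mem_head.
  rewrite (eq_bigr _ (fun b _ => dE b)) big_split /= -[X in X < _]add0n ltn_add2r.
  by rewrite (bigD1 a) //= addn_gt0 muln_gt0 mdeg_gt0 ap.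
have [s [sP sE sT]] := IH _ lt_k (balanced_sub cp bd dE).
exists ((t, p) :: s); split=> [x|b|x0 [|i]].
- by rewrite inE => /predU1P[->|/sP].
- by rewrite big_cons dE sE.
(* The arrow [e] of [p] has [delta e] equal to 1, so its residue is 0 and every later term of the
   sum at [e] vanishes. *)
- move=> _ /= tF; have /allPn[e ep de] := tF; exists e => // -[//|j] /=; rewrite ltnS => js.
  have de0 : delta' e = 0.
    rewrite /delta' (mdeg_qprimitive _ pp) ep (negPf tF).
    by move: de; case: (delta e) => [|[|]].
  move: (sE e); rewrite de0 (big_nth x0) big_mkord (bigD1 (Ordinal js)) //=.
  rewrite -mdeg_gt0 -eqn0Ngt => /esym/eqP; rewrite addn_eq0 muln_eq0 /=.
  by case/andP.
- move=> /= ls tF; have [e ep ej] := sT x0 i ls tF.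
  by exists e => // -[//|j] /ej.
Qed.

(** * Underlying undirected graphs of arrow sets, and counting arrows *)

Definition varrow S : rel 'I_n := fun u v =>
  [exists a in S, ((tl a == u) && (hd a == v)) || ((tl a == v) && (hd a == u))].

Lemma varrowC S : symmetric (varrow S).
Proof. by move=> u v; apply: eq_existsb => a; rewrite orbC. Qed.

Lemma pverts_const p W u v : qclosed tl hd p ->
    (forall a, a \in p -> (tl a \in W) = (hd a \in W)) ->
  u \in pverts tl hd p -> v \in pverts tl hd p -> (u \in W) = (v \in W).
Proof.
move=> cp HW; rewrite pvertsE // !inE => /mapP[a ap ->] /mapP[b bp ->].
case: p cp HW ap bp => // x p /= /andP[+ _]; elim: p x a b => [|y p IH] x a b /=.
  by move=> _ _; rewrite !mem_seq1 => /eqP-> /eqP->.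
case/andP=> /eqP xy Pp HW.
have Hyx : (hd y \in W) = (hd x \in W) by rewrite xy HW // !inE eqxx orbT.
have {}IH a' b' := IH y a' b' Pp (fun z zp => HW z (mem_behead (s := x :: y :: p) zp)).
rewrite in_cons => /predU1P[->|ap]; rewrite in_cons => /predU1P[->|bp] //; last exact: IH.
  by rewrite -Hyx; apply: IH; rewrite ?mem_head.
by rewrite -Hyx; apply: IH; rewrite ?mem_head.
Qed.

Lemma varrow_conn S : 0 < n ->
    (forall W, W != set0 ->
       (forall a, a \in S -> (tl a \in W) = (hd a \in W)) -> W = setT) ->
  conn (varrow S) setT.
Proof.
move=> n0 HS; apply/connP; split=> [|W WT W0].
  by rewrite -card_gt0 cardsT card_ord.
have [/existsP[a /andP[aS aW]]|nW] :=
  boolP [exists a, (a \in S) && ((tl a \in W) != (hd a \in W))].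
  case: (boolP (tl a \in W)) aW => [tW|tW]; last rewrite negbK => hW.
    rewrite eq_sym eqb_id => hW; exists (tl a), (hd a); split=> //.
    by apply/exists_inP; exists a; rewrite ?eqxx.
  exists (hd a), (tl a); split=> //.
  by apply/exists_inP; exists a; rewrite ?eqxx ?orbT.
suff E : W = setT by rewrite E properxx in WT.
apply: HS => // a aS; apply/eqP; apply: contraNT nW => aW.
by apply/existsP; exists a; rewrite aS.
Qed.

(** Spanning tree count: each vertex added to a growing connected set brings a new arrow. *)
Lemma leq_card_varrow S : conn (varrow S) setT -> n <= #|S|.+1.
Proof.
pose P (W : {set 'I_n}) := exists S' : {set 'I_d},
  [/\ S' \subset S, #|W| <= #|S'|.+1 & forall a, a \in S' -> (tl a \in W) && (hd a \in W)].
move=> cS; suff [S' [S'S + _]] : P setT.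
  by rewrite cardsT card_ord => /leq_trans; apply; rewrite ltnS subset_leq_card.
apply: conn_ind cS => [x _|Z z y _ [S' [S'S ZS' HS']] zZ _ yZ].
  by exists set0; rewrite sub0set cards1 cards0; split=> // a; rewrite inE.
case/exists_inP=> a aS ha; exists (a |: S').
have aS' : a \notin S'.
  apply: contra yZ => /HS'/andP[tZ hZ].
  by case/orP: ha => /andP[/eqP E /eqP E']; rewrite -?E -?E' ?tZ ?hZ // -E.
split=> [||b /setU1P[->|/HS'/andP[tZ hZ]]].
- by rewrite subUset sub1set aS.
- by rewrite !cardsU1 aS' yZ.
- by case/orP: ha => /andP[/eqP-> /eqP->]; rewrite !inE zZ eqxx ?orbT.
- by rewrite !inE tZ hZ !orbT.
Qed.

(* Deleting [e 0], [e 1], ... in turn keeps the quiver connected: the cycle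
   [c i] survives until [e i] goes. *)
Lemma triangular_cycles N (c : 'I_N -> seq 'I_d) (e : 'I_N -> 'I_d) :
    0 < n -> strongly_connected tl hd ->
    (forall i, qclosed tl hd (c i)) -> (forall i, e i \in c i) ->
    (forall i j : 'I_N, i < j -> e i \notin c j) ->
  N + n <= d.+1.
Proof.
move=> n0 [p [cp pT]] cc ec ecj.
have einj : injective e.
  move=> i j eij; apply/val_inj; case: (ltngtP i j) => // /ecj.
    by rewrite eij ec.
  by rewrite -eij ec.
have /leq_card_varrow : conn (varrow (~: (e @: setT))) setT; last first.
  move=> nE; have := cardsC (e @: setT); rewrite card_ord card_imset // cardsT card_ord => <-.
  by rewrite -addnS leq_add2l.
apply: varrow_conn => // W /set0Pn[w wW] HW.
(* If [W] separates the ends of no arrow, the closed path through all vertices forces [W] to be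
   everything. *)
suff HA a : (tl a \in W) = (hd a \in W).
  apply/setP=> v; rewrite inE -wW; apply: (pverts_const cp) => //; exact: (subsetP pT).
(* Deleted arrows [e i] are treated from the last index backwards. *)
have [/imsetP[i _ ->]|aE] := boolP (a \in e @: setT); last by apply: HW; rewrite inE.
have [k] := ubnP (N - i); elim: k i => // k IH i ik.
(* The closed path [c i] enters and leaves [W] equally often; once its other arrows are known not to
   cross, neither does [e i]. *)
have := balanced_mdeg (cc i) (fun v => v \in W).
rewrite (bigD1 (e i)) //= [in RHS](bigD1 (e i)) //=.
rewrite [X in _ + X = _](_ : _ = \sum_(b | b != e i) mdeg (c i) b * (tl b \in W)).
  move/addIn/eqP; rewrite eqn_mul2l -[_ == 0]negbK -lt0n mdeg_gt0 ec /=.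
  by case: (tl _ \in W); case: (hd _ \in W).
apply: eq_bigr => b bi; have [bc|] := boolP (b \in c i); last first.
  by rewrite -mdeg_gt0 -eqn0Ngt => /eqP->.
congr (_ * nat_of_bool _); apply/esym.
(* Another deleted arrow [e j] on [c i] has [j > i] by triangularity, so the induction covers it. *)
have [/imsetP[j _ Eb]|bE] := boolP (b \in e @: setT); last by apply: HW; rewrite inE.
rewrite Eb; apply: IH; rewrite -ltnS; apply: leq_trans ik; rewrite ltnS.
apply: ltn_sub2l => //; case: (ltngtP i j) => // [/ecj|/val_inj ij].
  by rewrite -Eb bc.
by rewrite Eb ij eqxx in bi.
Qed.

(** * The graph of closed paths, adjacent when they share a vertex *)

Definition meet_rel (T : finType) (c : T -> seq 'I_d) : rel T := fun i j =>
  pverts tl hd (c i) :&: pverts tl hd (c j) != set0.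

Lemma meet_relC (T : finType) (c : T -> seq 'I_d) : symmetric (meet_rel c).
Proof. by move=> i j; rewrite /meet_rel setIC. Qed.

(** Paths are spliced in one at a time, each at a vertex shared with a path already used. *)
Lemma conn_splice (T : finType) (c : T -> seq 'I_d) (Y : {set T}) :
    (forall i, qclosed tl hd (c i)) -> conn (meet_rel c) Y ->
  exists2 p, qclosed tl hd p & forall a, (a \in p) = [exists i in Y, a \in c i].
Proof.
pose P (Z : {set T}) := exists2 p, qclosed tl hd p &
  forall a, (a \in p) = [exists i in Z, a \in c i].
move=> cc cY; suff: P Y by [].
apply: conn_ind cY => [i _|Z z y _ [p cp pZ] zZ _ _ /set0Pn[v /setIP[vz vy]]].
  exists (c i) => // a; apply/idP/exists_inP => [ai|[j /set1P->]//].
  by exists i; rewrite ?inE.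
have vp : v \in pverts tl hd p.
  move: vz; rewrite !pvertsE // !inE => /mapP[a az ->]; apply: map_f.
  by rewrite pZ; apply/exists_inP; exists z.
have [r cr rE] := qclosed_splice cp (cc y) vp vy; exists r => // a.
rewrite rE mem_cat pZ; apply/orP/exists_inP => [[/exists_inP[i iZ ai]|ay]|[i]].
- by exists i; rewrite // inE iZ orbT.
- by exists y; rewrite ?setU11.
- by case/setU1P=> [->|iZ] ai; [right|left; apply/exists_inP; exists i].
Qed.

(** If no path of [Z] met a path outside, the vertices covered by [Z] would be separated from the
    rest by no arrow, contradicting strong connectivity. *)
Lemma meet_conn (T : finType) (c : T -> seq 'I_d) : 0 < #|T| ->
    strongly_connected tl hd -> (forall i, qclosed tl hd (c i)) ->
    (forall a, exists i, a \in c i) ->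
  conn (meet_rel c) setT.
Proof.
move=> T0 [p [cp pT]] cc cov; apply/connP; split=> [|Z].
  by rewrite -card_gt0 cardsT.
case/properP=> _ [y _ yZ] /set0Pn[z zZ].
have [/exists_inP[i iZ /exists_inP[j jZ ij]]|none] :=
  boolP [exists i in Z, [exists j in ~: Z, meet_rel c i j]].
  by exists i, j; rewrite !inE in jZ *.
pose W := \bigcup_(i in Z) pverts tl hd (c i).
have out i v : i \notin Z -> v \in pverts tl hd (c i) -> v \notin W.
  move=> iZ vi; apply: contra none => /bigcupP[j jZ vj].
  apply/exists_inP; exists j => //; apply/exists_inP; exists i; rewrite ?inE //.
  by apply/set0Pn; exists v; rewrite inE vj.
have /set0Pn[u uz] := pverts_neq0 (cc z); have /set0Pn[v vy] := pverts_neq0 (cc y).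
have uW : u \in W by apply/bigcupP; exists z.
suff : (u \in W) = (v \in W) by rewrite uW (negPf (out _ _ yZ vy)).
apply: (pverts_const cp); try exact: (subsetP pT).
move=> a _; have [i ai] := cov a.
have ti := tl_pverts (cc i) ai; have hi := hd_pverts (cc i) ai.
case: (boolP (i \in Z)) => iZ; last by rewrite !(negPf (out _ _ iZ _)).
by transitivity true; [|apply/esym]; apply/bigcupP; exists i.
Qed.

(** Double counting: a primitive path has as many vertices as arrows, and each vertex lies on at
    most one path of [I]. *)
Lemma indep_size_leq (T : finType) (c : T -> seq 'I_d) (I : {set T}) :
  (forall i, qprimitive tl hd (c i)) -> indep (meet_rel c) I ->
  \sum_(i in I) size (c i) <= n.
Proof.
move=> cc iI; under eq_bigr do rewrite -(card_pverts (cc _)) -sum1_card big_mkcond /=.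
rewrite exchange_big /= -[leqRHS]card_ord -sum1_card; apply: leq_sum => v _.
rewrite -big_mkcondr /= sum1_card; apply/card_le1_eqP => i j /andP[iI' vi] /andP[jI vj].
by apply: iI => //; apply/set0Pn; exists v; rewrite inE; apply/andP.
Qed.

End ClosedPaths.

(** * Decomposition of an element of [Omega2] and the length bound *)

Section Bound.
Variables (n d m : nat) (tl hd : 'I_d -> 'I_n) (delta : 'I_d -> nat).
Hypotheses (scQ : strongly_connected tl hd) (mQ : mQ_is tl hd m).
Hypothesis deltaO : Omega2 tl hd delta.

(** [delta] is balanced, being the multidegree of a closed path, and positive on every arrow, whence
    the covering; [t] indexes the doubled paths. *)
Lemma Omega2_decomposition : exists (N : nat) (c : 'I_N -> seq 'I_d) (t : {set 'I_N}),
  [/\ forall i, qprimitive tl hd (c i), forall a, exists i, a \in c i,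
      forall b, delta b = \sum_i (i \in t : nat).+1 * mdeg (c i) b &
      forall i, i \notin t -> exists2 e, e \in c i & forall j : 'I_N, i < j -> e \notin c j].
Proof.
have [[p [cp pT dp]] _] := deltaO.
have bd : balanced tl hd delta.
  move=> f; under eq_bigr do rewrite dp; under [RHS]eq_bigr do rewrite dp.
  by apply: balanced_mdeg.
have [s [sP sE sT]] := cycle_decomposition bd.
pose x0 : bool * seq 'I_d := (true, [::]).
exists (size s), (fun i => (nth x0 s i).2), [set i : 'I_(size s) | (nth x0 s i).1].
have dE b : delta b = \sum_(i < size s) ((nth x0 s i).1 : nat).+1 * mdeg (nth x0 s i).2 b.
  by rewrite sE (big_nth x0) big_mkord.
split=> [i|a|b|i].
- by apply/sP/mem_nth.
- case: (pickP (fun i : 'I_(size s) => a \in (nth x0 s i).2)) => [i|na]; first by exists i.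
  have : 0 < delta a by rewrite dp mdeg_gt0; have /setP/(_ a) := pT; rewrite !inE.
  rewrite dE big1 // => i _; have /negbT := na i; rewrite -mdeg_gt0 -eqn0Ngt => /eqP->.
  by rewrite muln0.
- by rewrite dE; apply: eq_bigr => i _; rewrite inE.
- rewrite inE => /(sT x0 i (ltn_ord i))[e ei ej]; exists e => // j ij.
  by rewrite ej // ij /=.
Qed.

Section Decomposition.
Variables (N : nat) (c : 'I_N -> seq 'I_d) (t : {set 'I_N}).
Hypothesis c_prim : forall i, qprimitive tl hd (c i).
Hypothesis c_cover : forall a, exists i, a \in c i.
Hypothesis deltaE : forall b, delta b = \sum_i (i \in t : nat).+1 * mdeg (c i) b.
Hypothesis c_triangular : forall i, i \notin t ->
  exists2 e, e \in c i & forall j : 'I_N, i < j -> e \notin c j.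

Let c_closed i : qclosed tl hd (c i). Proof. by case/andP: (c_prim i). Qed.

(** For [i] in [t] this is the support of [delta - 2 mdeg (c i)]. *)
Definition other_arrows i : {set 'I_d} := [set b | [exists j, (j != i) && (b \in c j)]].

Lemma doubled_cycle i : i \in t ->
  other_arrows i != set0 /\ ~ sub_strongly_connected tl hd (other_arrows i).
Proof.
move=> it; have dE b : delta b = 2 * mdeg (c i) b +
    \sum_(j | j != i) (j \in t : nat).+1 * mdeg (c j) b.
  by rewrite deltaE (bigD1 i) //= it.
have dd : ddouble tl hd delta (c i).
  rewrite /ddouble c_prim; apply/allP=> a ai; rewrite dE.
  by rewrite (mdeg_qprimitive _ (c_prim i)) ai leq_addr.
have [_ /(_ _ dd)[[a aE] nS _]] := deltaO.
have suppE : dsupport (fun b => delta b - 2 * mdeg (c i) b) = other_arrows i.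
  apply/setP=> b; rewrite !inE dE addKn lt0n sum_nat_eq0 negb_forall.
  apply: eq_existsb => j; rewrite negb_imply; congr (_ && _).
  by rewrite muln_eq0 /= -lt0n mdeg_gt0.
split; last by rewrite -suppE.
by apply/set0Pn; exists a; rewrite -suppE inE.
Qed.

(** Otherwise the other paths splice into one closed path, making the support of the difference
    strongly connected. *)
Lemma doubled_cut i : i \in t -> ~~ conn (meet_rel tl hd c) (setT :\ i).
Proof.
move=> /doubled_cycle[_ nS]; apply/negP=> /(conn_splice c_closed)[p cp pE].
have pS a : (a \in p) = (a \in other_arrows i).
  by rewrite pE inE; apply: eq_existsb => j; rewrite !inE andbT.
apply: nS; exists p; split=> //; first by apply/allP=> a; rewrite pS.
apply/subsetP=> v; rewrite inE => /exists_inP[a]; rewrite -pS => ap.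
by case/orP=> /eqP<-; [apply: tl_pverts | apply: hd_pverts].
Qed.

(** Otherwise the other paths use every arrow of the quiver, and strong connectivity of the whole
    contradicts decomposability. *)
Lemma doubled_private i : i \in t -> exists2 e, e \in c i & forall j, j != i -> e \notin c j.
Proof.
move=> /doubled_cycle[_ nS].
have [/exists_inP[e ei eS]|H] := boolP [exists e in c i, e \notin other_arrows i].
  exists e => // j ji; apply: contra eS => ej; rewrite inE.
  by apply/existsP; exists j; rewrite ji.
case: nS; have [p [cp pT]] := scQ; exists p; split=> //; last first.
  exact: subset_trans (subsetT _) pT.
apply/allP=> a _; have [j aj] := c_cover a.
have [ji|ji] := eqVneq j i; last by rewrite inE; apply/existsP; exists j; rewrite ji.
by apply: contraNT H => aS; apply/exists_inP; exists a; rewrite // -ji.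
Qed.

Lemma qprimitive_size_leq p : qprimitive tl hd p -> size p <= m.
Proof. by case: mQ => _; apply. Qed.

Lemma mQ_leq : m <= n.
Proof.
case: mQ => -[p [pp <-]] _; rewrite -(card_pverts pp) -[leqRHS]card_ord.
exact: max_card.
Qed.

Lemma nverts_gt0 : 0 < n.
Proof.
by have [[|a p] [// _ _]] := scQ; apply: leq_ltn_trans (ltn_ord (tl a)).
Qed.

(** Private arrows of doubled paths and exhausted arrows of the others together form a triangular
    system. *)
Lemma cycles_card : N + n <= d.+1.
Proof.
have ex i : exists e, e \in c i /\ forall j : 'I_N, i < j -> e \notin c j.
  have [/doubled_private|/c_triangular] := boolP (i \in t);
    case=> e ei ej; exists e; split=> // j ij.
  by apply: ej; rewrite -val_eqE gtn_eqF.
have /fin_all_exists[e eP] := ex.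
by apply: (triangular_cycles nverts_gt0 scQ c_closed (e := e)) => i; case: (eP i).
Qed.

Lemma sum_deltaE : \sum_a delta a = \sum_i size (c i) + \sum_(i in t) size (c i).
Proof.
under eq_bigr do rewrite deltaE; rewrite exchange_big /= [X in _ + X]big_mkcond.
rewrite -big_split; apply: eq_bigr => i _; rewrite -big_distrr /=.
have -> : \sum_b mdeg (c i) b = size (c i).
  by have := sum_mdeg (c i) (fun=> 1); under eq_bigr do rewrite muln1; rewrite sum1_size.
by case: (i \in t); rewrite ?mul2n ?mul1n ?addn0 // addnn.
Qed.

Lemma sum_size_leq (A : {set 'I_N}) : \sum_(i in A) size (c i) <= m * #|A|.
Proof.
rewrite mulnC -sum_nat_const; apply: leq_sum => i _.
exact: qprimitive_size_leq.
Qed.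

(** The classes [I] and [J] contribute at most [n] each; every other path, and every second copy, at
    most [m]. The witness [x] avoids truncated subtraction. *)
Lemma sum_delta_leq : 1 < N ->
  exists2 x, x + n < d & \sum_a delta a <= m * x + 2 * n.
Proof.
move=> N1; have cQ : conn (meet_rel tl hd c) setT.
  by apply: meet_conn => //; rewrite card_ord ltnW.
have [|I [J [iI iJ dIJ _ bX]]] := conn_bipartite (meet_relC tl hd c) cQ.
  by rewrite cardsT card_ord.
set X := setT :\: (I :|: J) in bX.
have nc : #|noncut (meet_rel tl hd c) setT| <= #|~: t|.
  apply/subset_leq_card/subsetP=> i; rewrite !inE /=.
  by apply: contraL => /doubled_cut.
have ct := cardsC t; rewrite card_ord in ct.
have NN := cycles_card.
(* [#|X| + 2 <= #|~: t|] gives [#|X| + #|t| + 2 <= N], and [N + n <= d.+1]. *)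
exists (#|X| + #|t|); first lia.
have SX := sum_size_leq X; have St := sum_size_leq t.
have SI := indep_size_leq c_prim iI; have SJ := indep_size_leq c_prim iJ.
have -> : \sum_a delta a = \sum_(i in I) size (c i) + \sum_(i in J) size (c i)
    + \sum_(i in X) size (c i) + \sum_(i in t) size (c i).
  rewrite sum_deltaE (bigID (mem (I :|: J))) /=; congr (_ + _ + _).
    by rewrite -bigU //=; apply: eq_bigl => i; rewrite !inE.
  by apply: eq_bigl => i; rewrite !inE andbT.
by rewrite [leqRHS]addnC mul2n -addnn mulnDr addnA; do 3 apply: leq_add => //.
Qed.

(** A doubled path requires arrows on other paths, so a lone path is taken once. *)
Lemma sum_delta_leq1 : N <= 1 -> \sum_a delta a <= m.
Proof.
move=> N1; have only (i j : 'I_N) : i = j.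
  by case: i j => i iN [j jN]; apply/val_inj => /=; lia.
rewrite sum_deltaE [X in _ + X]big1 => [|i /doubled_cycle[/set0Pn[b bi] _]]; last first.
  by move: bi; rewrite inE => /existsP[j /andP[]]; rewrite (only j i) eqxx.
rewrite addn0; have := sum_size_leq setT; rewrite cardsT card_ord.
under eq_bigl do rewrite inE.
by move/leq_trans; apply; rewrite -{2}[m]muln1 leq_mul2l N1 orbT.
Qed.

End Decomposition.
End Bound.

Import GRing.Theory Num.Theory.
Local Open Scope ring_scope.

Theorem theorem3p9 (n d m : nat) (tl hd : 'I_d -> 'I_n) (delta : 'I_d -> nat) :
  strongly_connected tl hd -> mQ_is tl hd m -> Omega2 tl hd delta ->
  ((\sum_(a < d) delta a)%N%:Z <= m%:Z * (d%:Z - n%:Z - 1) + 2 * n%:Z).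
Proof.
move=> scQ mQ dO.
have [N [c [t [cP cC dE cT]]]] := Omega2_decomposition dO.
(* For [N = 1], [n <= d] makes the bound at least [2n - m], which is at least [m] because
   [m <= n]. *)
have [N1|N1] := leqP N 1.
  have H := sum_delta_leq1 mQ dO cP dE N1.
  have mn := mQ_leq mQ.
  have := cycles_card scQ dO cP cC dE cT.
  have : (0 < N)%N.
    have [[|a p] [// _ _]] := scQ; have [i _] := cC a; exact: leq_ltn_trans (ltn_ord i).
  move: (\sum_a _)%N H => s; nia.
have [x xd H] := sum_delta_leq scQ mQ dO cP cC dE cT N1.
move: (\sum_a _)%N H => s; nia.
Qed.
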